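(* Let $k\geq 3$ and $n\geq 1$, and let $\mathsf{A}\in\mathbb{R}^{n\times n\times\cdots\times n}$ be a $k$th order supersymmetric tensor that is orthogonally decomposable, with orthogonal decomposition $\mathsf{A}=\sum_{r=1}^n\lambda_r\,\mathbf{v}_r\circ\mathbf{v}_r\circ\cdots\circ\mathbf{v}_r$ ($k$ factors in each term). Let the initial condition be $\mathbf{x}_0=\sum_{r=1}^n c_r\mathbf{v}_r$ with $c_r\in\mathbb{R}$. Then the solution at time $q$ of the multilinear dynamical system $\mathbf{x}_{t+1}=\mathsf{A}\mathbf{x}_t^{k-1}$ with initial condition $\mathbf{x}_0$ is $$\mathbf{x}_q=\sum_{r=1}^n\lambda_r^{\alpha}c_r^{\beta}\,\mathbf{v}_r,$$ where $\alpha=\sum_{j=0}^{q-1}(k-1)^j=\frac{(k-1)^q-1}{k-2}$ and $\beta=(k-1)^q$.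
   Context: A $k$th order tensor $\mathsf{A}\in\mathbb{R}^{n\times\cdots\times n}$ ($k$ modes, each of size $n$) is supersymmetric if its entries $\mathsf{A}_{j_1j_2\dots j_k}$ are invariant under any permutation of the indices. The symbol $\circ$ denotes the vector outer product, so the $k$-fold product $\mathbf{v}\circ\cdots\circ\mathbf{v}$ has entries $\mathbf{v}_{j_1}\mathbf{v}_{j_2}\cdots\mathbf{v}_{j_k}$. A supersymmetric tensor is orthogonally decomposable (odeco) if it can be written as $\mathsf{A}=\sum_{r=1}^n\lambda_r\,\mathbf{v}_r\circ\cdots\circ\mathbf{v}_r$ ($k$ factors) with $\lambda_r\in\mathbb{R}$ in descending order and $\mathbf{v}_1,\dots,\mathbf{v}_n\in\mathbb{R}^n$ orthonormal; such an expression is called an orthogonal decomposition. The vector $\mathsf{A}\mathbf{x}^{k-1}\in\mathbb{R}^n$ is the contraction of $\mathsf{A}$ with $\mathbf{x}$ along $k-1$ modes: $(\mathsf{A}\mathbf{x}^{k-1})_{j}=\sum_{j_1,\dots,j_{k-1}=1}^n\mathsf{A}_{j_1\dots j_{k-1}j}\,\mathbf{x}_{j_1}\cdots\mathbf{x}_{j_{k-1}}$. Time $t=0,1,2,\dots$ is discrete, and $q$ is a nonnegative integer (with $\lambda^0=1$). *)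

(* Defs.v *)
From mathcomp Require Import all_boot all_order all_fingroup all_algebra.
From mathcomp Require Import reals.

Set Implicit Arguments.
Unset Strict Implicit.
Unset Printing Implicit Defensive.

Import Order.TTheory GRing.Theory Num.Theory.

Local Open Scope ring_scope.

(* k-th order tensors with k modes of size n, indexed by (j_1, ..., j_k); R^o is R as a
   module over itself, giving tensors their linear structure. *)
Notation tensor R n k := {ffun k.-tuple 'I_n -> R^o}.

Definition supersymmetric (R : realType) (n k : nat) (A : tensor R n k) : Prop :=
  forall (s : 'S_k) (J : k.-tuple 'I_n),
    A [tuple tnth J (s i) | i < k] = A J.

Definition outer (R : realType) (n k : nat) (u : 'I_k -> 'cV[R]_n) :
    tensor R n k :=
  [ffun J : k.-tuple 'I_n => \prod_(i < k) u i (tnth J i) 0].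

Definition orthonormal (R : realType) (n : nat) (v : 'I_n -> 'cV[R]_n) : Prop :=
  forall r s : 'I_n, (v r)^T *m v s = (r == s)%:R%:M.

Definition orthogonal_decomposition (R : realType) (n k : nat)
    (A : tensor R n k) (lambda : 'I_n -> R) (v : 'I_n -> 'cV[R]_n) : Prop :=
  [/\ forall r s : 'I_n, (r <= s)%N -> lambda s <= lambda r,
      orthonormal v
    & A = \sum_(r < n) lambda r *: outer (fun _ : 'I_k => v r)].

(* The vector A x^(k-1).  For k >= 1 the tuple [nth j J i | i < k] is
   (J_1, ..., J_(k-1), j): J has k - 1 entries, so the default value j of nth
   is used exactly at the last position. *)
Definition contract (R : realType) (n k : nat) (A : tensor R n k)
    (x : 'cV[R]_n) : 'cV[R]_n :=
  \col_j \sum_(J : k.-1.-tuple 'I_n)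
    A [tuple nth j J i | i < k] * \prod_(i < k.-1) x (tnth J i) 0.

Definition solution (R : realType) (n k : nat) (A : tensor R n k)
    (x0 : 'cV[R]_n) (x : nat -> 'cV[R]_n) : Prop :=
  x 0%N = x0 /\ forall t : nat, x t.+1 = contract A (x t).

(* Main.v *)
(** In the basis [v], the map [x |-> A x^(k-1)] acts coordinatewise by
    [c |-> lambda * c ^ (k-1)]: contracting [u o ... o u] with [x] gives
    [<u, x>^(k-1) u].  Iterating, the exponents obey
    [alpha_(q+1) = 1 + (k-1) alpha_q] and [beta_(q+1) = (k-1) beta_q]. *)

Require Import Defs.
From mathcomp Require Import all_boot all_order all_fingroup all_algebra.
From mathcomp Require Import reals ring.

Set Implicit Arguments.
Unset Strict Implicit.
Unset Printing Implicit Defensive.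

Import Order.TTheory GRing.Theory Num.Theory.

Local Open Scope ring_scope.

(** Distributivity expands the power, a product of [m] equal sums, into a sum over finite functions
    ['I_m -> 'I_n]; these are in bijection with [m]-tuples. *)
Lemma sum_tuple_prod (R : comPzSemiRingType) (n m : nat) (f : 'I_n -> R) :
  \sum_(J : m.-tuple 'I_n) \prod_(i < m) f (tnth J i) = (\sum_j f j) ^+ m.
Proof.
rewrite -[in RHS](card_ord m) -prodr_const bigA_distr_bigA /=.
rewrite (reindex (fun g : {ffun 'I_m -> 'I_n} => [tuple g i | i < m])) /=.
  by apply: eq_bigr => g _; apply: eq_bigr => i _; rewrite tnth_mktuple.
exists (fun J : m.-tuple 'I_n => [ffun i => tnth J i]) => [g _|J _].
  by apply/ffunP => i; rewrite ffunE tnth_mktuple.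
by apply: eq_from_tnth => i; rewrite tnth_mktuple ffunE.
Qed.

(** The factor of [u] at the free index does not depend on the summed tuple; what remains is a sum
    of products that factors into [m] copies of the inner product. *)
Lemma contract_outer (R : realType) (n m : nat) (u x : 'cV[R]_n) :
  contract (outer (fun _ : 'I_m.+1 => u)) x = (u^T *m x) 0 0 ^+ m *: u.
Proof.
apply/colP => j; rewrite !mxE /=.
under [X in X ^+ m]eq_bigr do rewrite mxE.
rewrite -sum_tuple_prod mulr_suml.
apply: eq_bigr => J _.
(* The last position lies just past the end of [J], so [nth] returns its default [j], which splits
   off the factor [u j 0]. *)
rewrite ffunE big_ord_recr tnth_mktuple /= nth_default ?size_tuple //.
rewrite mulrAC -big_split /=; congr (_ * _).
by apply: eq_bigr => i _; rewrite tnth_mktuple -tnth_nth.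
Qed.

Lemma contract_sum (R : realType) (n k : nat) (I : finType) (a : I -> R)
    (T : I -> tensor R n k) (x : 'cV[R]_n) :
  contract (\sum_r a r *: T r) x = \sum_r a r *: contract (T r) x.
Proof.
apply/colP => j; rewrite summxE mxE.
under eq_bigr do rewrite sum_ffunE mulr_suml.
rewrite exchange_big; apply: eq_bigr => r _ /=.
rewrite !mxE mulr_sumr; apply: eq_bigr => J _.
by rewrite ffunE mulrA.
Qed.

(* Unqualified, [orthonormal] would be the notion from mathcomp's sesquilinear forms. *)
Lemma orthonormal_coord (R : realType) (n : nat) (v : 'I_n -> 'cV[R]_n)
    (d : 'I_n -> R) (r : 'I_n) :
  Defs.orthonormal v -> ((v r)^T *m \sum_(s < n) d s *: v s) 0 0 = d r.
Proof.
move=> ov; rewrite mulmx_sumr summxE (bigD1 r) //= big1 => [|s sr].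
  by rewrite -scalemxAr ov eqxx !mxE eqxx mulr1 addr0.
by rewrite -scalemxAr ov eq_sym (negPf sr) !mxE mul0rn mulr0.
Qed.

Lemma contract_odeco (R : realType) (n m : nat) (A : tensor R n m.+1)
    (lambda : 'I_n -> R) (v : 'I_n -> 'cV[R]_n) (d : 'I_n -> R) :
  orthogonal_decomposition A lambda v ->
  contract A (\sum_(r < n) d r *: v r)
    = \sum_(r < n) (lambda r * d r ^+ m) *: v r.
Proof.
case=> _ ov ->; rewrite contract_sum; apply: eq_bigr => r _.
by rewrite contract_outer orthonormal_coord // scalerA.
Qed.

Lemma sum_expn_recl (m q : nat) :
  (\sum_(0 <= j < q.+1) m ^ j = 1 + m * \sum_(0 <= j < q) m ^ j)%N.
Proof.
rewrite big_nat_recl // expn0 big_distrr /=; congr addn.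
by apply: eq_bigr => j _; rewrite expnS.
Qed.

Theorem proposition1 (R : realType) (k n : nat) (hk : (3 <= k)%N) (hn : (1 <= n)%N)
    (A : tensor R n k) (hA : supersymmetric A)
    (lambda : 'I_n -> R) (v : 'I_n -> 'cV[R]_n)
    (hdec : orthogonal_decomposition A lambda v)
    (c : 'I_n -> R) (x : nat -> 'cV[R]_n)
    (hx : solution A (\sum_(r < n) c r *: v r) x) (q : nat) :
  let alpha := (\sum_(0 <= j < q) (k - 1) ^ j)%N in
  let beta := ((k - 1) ^ q)%N in
  x q = \sum_(r < n) (lambda r ^+ alpha * c r ^+ beta) *: v r
  /\ alpha%:R = ((k%:R - 1) ^+ q - 1) / (k%:R - 2) :> R.
Proof.
(* Writing [k] as [m.+1] makes [k.-1] compute to [m], the form [contract_odeco] expects. *)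
case: k hk A hA hdec hx => [//|m] hm A _ hdec [x0 xS].
rewrite subn1 /= -natr1 addrK; split.
  elim: q => [|q IHq].
    by rewrite x0; apply: eq_bigr => r _; rewrite big_geq // mul1r.
  rewrite xS IHq (contract_odeco _ hdec); apply: eq_bigr => r _.
  (* Both sides become [lambda r] times [m]-th powers, by the two exponent recurrences. *)
  rewrite sum_expn_recl exprD expr1 exprMn -!exprM -mulrA.
  by rewrite [(m * _)%N]mulnC expnSr.
(* Here [k >= 3] enters: [m >= 2] keeps the denominator [k - 2 = m - 1] nonzero. *)
have m1 : m%:R - 1 != 0 :> R by rewrite subr_eq0 pnatr_eq1 gtn_eqF.
have -> : m%:R + 1 - 2 = m%:R - 1 :> R by ring.
(* With the denominator cleared, this is the factorization of [m ^ q - 1] by [m - 1]. *)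
apply: (canRL (mulfK m1)); rewrite natr_sum big_mkord mulrC subrX1.
by congr (_ * _); apply: eq_bigr => j _; rewrite natrX.
Qed.
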